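(* Let $a,b,c>0$ be real numbers and let $a_{010},k_{010},b_{002}\in\mathbb{R}$ with $a_{010}\neq0$ and $b^2k_{010}\neq 2b_{002}c^2$. The polynomial differential system $$ \begin{aligned} \dot{x}&=a_{010}\, y,\\ \dot{y}&=\frac12\left( b^2\left(-k_{010} + \frac{x(-2 a_{010} + k_{010} x)}{a^2}\right) + k_{010}\, y^2 + 2 b_{002}\, z^2\right),\\ \dot{z}&= \frac12\left(-\frac{2 b_{002} c^2}{b^2} + k_{010}\right) y z \end{aligned} $$ is a polynomial differential system on the ellipsoid $\mathbb{E}^2=\{(x,y,z)\in\mathbb{R}^3: x^2/a^2+y^2/b^2+z^2/c^2=1\}$, the degrees of its components listed in nonincreasing order are $(m_1,m_2,m_3)=(2,2,1)$, and its number of invariant parallels reaches the value $m_3=1$.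
   Context: Let $M=x^2/a^2+y^2/b^2+z^2/c^2-1$. A polynomial differential system $\dot x=P_1,\ \dot y=P_2,\ \dot z=P_3$ is identified with the vector field $\mathcal{X}=P_1\partial_x+P_2\partial_y+P_3\partial_z$. It is a system on $\mathbb{E}^2=\{M=0\}$ if $\mathcal{X}M=0$ at every point of $\mathbb{E}^2$. For a polynomial $f$, the set $\{f=0\}\cap\mathbb{E}^2$ is invariant for $\mathcal{X}$ on $\mathbb{E}^2$ if (i) there is a polynomial $k$ with $\mathcal{X}f=kf$ at all points of $\mathbb{E}^2$, and (ii) $\nabla M$ and $\nabla f$ are linearly independent at every point of $\{f=0\}\cap\mathbb{E}^2$. A parallel of $\mathbb{E}^2$ is a closed curve obtained as the intersection of $\mathbb{E}^2$ with a plane $z=z_0$, $z_0$ a real constant with $|z_0|<c$. An invariant parallel is a parallel for which $\{z-z_0=0\}\cap\mathbb{E}^2$ is invariant for $\mathcal{X}$ on $\mathbb{E}^2$, that is, with $f=z-z_0$, there is a polynomial $k$ with $\mathcal{X}f=kf$ at all points of $\mathbb{E}^2$, and $\nabla M$ and $\nabla f$ are linearly independent at every point of $\{f=0\}\cap\mathbb{E}^2$. The general upper bound for the number of invariant parallels, for a polynomial vector field on $\mathbb{E}^2$ of degree $(m_1,m_2,m_3)$ with $m_1\ge m_2\ge m_3$ having finitely many invariant parallels, is $m_3$. *)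

(* Defs.v *)
From mathcomp Require Import all_boot all_order all_algebra.
From mathcomp Require Import classical_sets cardinality reals.
From mathcomp Require Import mpoly.

Set Implicit Arguments.
Unset Strict Implicit.
Unset Printing Implicit Defensive.

Import Order.TTheory GRing.Theory Num.Theory.

Local Open Scope classical_set_scope.
Local Open Scope ring_scope.

(* Polynomials in R[x, y, z] are {mpoly R[3]}, the variables x, y, z having the
   indices 0, 1, 2; points of R^3 are row vectors. *)
Definition varx {R : realType} : {mpoly R[3]} := 'X_(@Ordinal 3 0 isT).
Definition vary {R : realType} : {mpoly R[3]} := 'X_(@Ordinal 3 1 isT).
Definition varz {R : realType} : {mpoly R[3]} := 'X_(@Ordinal 3 2 isT).

Definition evalpt (R : realType) (f : {mpoly R[3]}) (p : 'rV[R]_3) : R :=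
  f.@[fun i => p ord0 i].

Definition zero_locus (R : realType) (f : {mpoly R[3]}) : set 'rV[R]_3 :=
  [set p | evalpt f p = 0].

Definition gradient (R : realType) (f : {mpoly R[3]}) (p : 'rV[R]_3) :
    'rV[R]_3 :=
  \row_(i < 3) evalpt f^`M(i) p.

(* A system x' = P1, y' = P2, z' = P3 is the vector field [tuple P1; P2; P3]. *)
Definition vector_field (R : realType) := 3.-tuple {mpoly R[3]}.

(* The polynomial X f = P1 df/dx + P2 df/dy + P3 df/dz. *)
Definition vf_apply (R : realType) (X : vector_field R) (f : {mpoly R[3]}) :
    {mpoly R[3]} :=
  \sum_(i < 3) tnth X i * f^`M(i).

(* Total degrees of the components, in nonincreasing order; msize is the total
   degree plus one, so the zero polynomial gets degree 0. *)
Definition vf_degrees (R : realType) (X : vector_field R) : seq nat :=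
  sort geq [seq (msize P).-1 | P <- X].

Section Ellipsoid.
Variables (R : realType) (a b c : R).

Definition ellipsoid_poly : {mpoly R[3]} :=
  (a ^+ 2)^-1 *: varx ^+ 2 + (b ^+ 2)^-1 *: vary ^+ 2
  + (c ^+ 2)^-1 *: varz ^+ 2 - 1.

Definition ellipsoid : set 'rV[R]_3 := zero_locus ellipsoid_poly.

Definition system_on_ellipsoid (X : vector_field R) : Prop :=
  forall p, ellipsoid p -> evalpt (vf_apply X ellipsoid_poly) p = 0.

(* Invariance of zero_locus f `&` ellipsoid; it depends on the defining
   polynomial f and not only on the set. *)
Definition invariant_on_ellipsoid (X : vector_field R) (f : {mpoly R[3]}) :
    Prop :=
  (exists k : {mpoly R[3]},
     forall p, ellipsoid p -> evalpt (vf_apply X f) p = evalpt (k * f) p) /\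
  (forall p, (zero_locus f `&` ellipsoid) p ->
     free [:: gradient ellipsoid_poly p; gradient f p]).

Definition plane_poly (z0 : R) : {mpoly R[3]} := varz - z0%:MP.

Definition parallel (z0 : R) : set 'rV[R]_3 :=
  zero_locus (plane_poly z0) `&` ellipsoid.

Definition invariant_parallels (X : vector_field R) : set (set 'rV[R]_3) :=
  [set C | exists z0 : R, [/\ `|z0| < c, C = parallel z0
                            & invariant_on_ellipsoid X (plane_poly z0)]].

End Ellipsoid.

Definition quadratic_system (R : realType) (a b c a010 k010 b002 : R) :
    vector_field R :=
  [tuple a010 *: vary;
         2^-1 *: (b ^+ 2 *: (- k010%:MP
                             + (a ^+ 2)^-1 *: (varx * (- (2 * a010)%:MP
                                                       + k010 *: varx)))
                  + k010 *: vary ^+ 2 + (2 * b002) *: varz ^+ 2);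
         (2^-1 * (- (2 * b002 * c ^+ 2 / b ^+ 2) + k010)) *: (vary * varz)].

(* Main.v *)
Require Import Defs.
From mathcomp Require Import all_boot all_order all_algebra.
From mathcomp Require Import classical_sets cardinality reals.
From mathcomp Require Import mpoly.
From mathcomp Require Import ring.

Import Order.TTheory GRing.Theory Num.Theory.

Local Open Scope classical_set_scope.
Local Open Scope ring_scope.
Local Open Scope card_scope.

(** The vector field X satisfies XM = k010 y M as a polynomial identity, because
    the terms of XM in a010 and in b002 cancel and those in k010 regroup into a
    multiple of M ([quadratic_system_cofactor]); hence XM vanishes on M = 0.

    The degrees are read off the components.  With
    K = (k010 - 2 b002 c^2 / b^2) / 2, which the hypothesis makes nonzero, the
    third component is K y z, of degree 2; for the second component, the same
    hypothesis prevents b002 and k010 from both vanishing, so one of the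
    monomials y^2, z^2 occurs.

    For the parallels, X(z - z0) is the third component, K y z.  If the parallel
    at height z0 is invariant, K y z vanishes on it; but for |z0| < c the
    parallel contains a point with y > 0, which forces z0 = 0
    ([invariant_parallel_height]).  Conversely the equator is invariant with
    cofactor K y ([equator_invariant]), the independence of the gradients being
    automatic since the tangent plane of the ellipsoid is horizontal only at the
    two poles ([parallel_gradients_free]). *)

(** * Polynomials in the coordinates: values, derivatives, coefficients *)

Lemma mderivXU (n : nat) (A : nzRingType) (i j : 'I_n) :
  ('X_i : {mpoly A[n]})^`M(j) = (i == j)%:R.
Proof.
rewrite mderivX mnm1E; case: eqVneq => [->|_]; last by rewrite scale0r.
by rewrite scale1r -[X in (X - _)%MM]addm0 addmC addmK mpolyX0.
Qed.

Lemma msizeXU (n : nat) (A : nzRingType) (i : 'I_n) :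
  msize ('X_i : {mpoly A[n]}) = 2.
Proof. by rewrite msizeX mdeg1. Qed.

Lemma mcoeff_sqr (n : nat) (A : nzRingType) (i j : 'I_n) :
  ('X_i ^+ 2 : {mpoly A[n]})@_(U_(j) *+ 2)%MM = (i == j)%:R.
Proof.
rewrite mcoeffXn; congr ((nat_of_bool _)%:R).
apply/idP/idP => [/eqP /mnmP /(_ i) | /eqP -> //].
by rewrite !mulmnE !mnm1E eqxx eq_sym; case: (i == j).
Qed.

Lemma mcoeff_lin_sqr (n : nat) (A : nzRingType) (i j : 'I_n) :
  ('X_i : {mpoly A[n]})@_(U_(j) *+ 2)%MM = 0.
Proof.
rewrite mcoeffX; case: eqP => // /(congr1 mdeg).
by rewrite mdegMn !mdeg1.
Qed.

Lemma mcoeff_const_sqr (n : nat) (A : nzRingType) (k : A) (j : 'I_n) :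
  (k%:MP : {mpoly A[n]})@_(U_(j) *+ 2)%MM = 0.
Proof. by rewrite mcoeffC -mdeg_eq0 mdegMn mdeg1 mulr0. Qed.

Section Coordinates.
Context {R : realType}.
Implicit Types (p : 'rV[R]_3) (f : {mpoly R[3]}).

Definition ix : 'I_3 := @Ordinal 3 0 isT.
Definition iy : 'I_3 := @Ordinal 3 1 isT.
Definition iz : 'I_3 := @Ordinal 3 2 isT.

Definition meval_simp := (mevalD, mevalB, mevalN, mevalZ, mevalM, mevalC, meval1,
  meval0, mevalXU).

Definition mderiv_simp := (mderivD, mderivB, mderivN, mderivZ, mderivM, mderivC,
  mderivXU).

Lemma sum_ord3 (V : nmodType) (F : 'I_3 -> V) :
  \sum_(i < 3) F i = F ix + F iy + F iz.
Proof.
rewrite !big_ord_recl big_ord0 addr0 addrA.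
by congr (F _ + F _ + F _); apply: val_inj.
Qed.

Lemma evalpt_ellipsoid (a b c : R) p :
  evalpt (ellipsoid_poly a b c) p =
  (a ^+ 2)^-1 * p ord0 ix ^+ 2 + (b ^+ 2)^-1 * p ord0 iy ^+ 2
  + (c ^+ 2)^-1 * p ord0 iz ^+ 2 - 1.
Proof. by rewrite /evalpt /ellipsoid_poly !expr2 !meval_simp. Qed.

Lemma evalpt_plane (z0 : R) p : evalpt (plane_poly z0) p = p ord0 iz - z0.
Proof. by rewrite /evalpt /plane_poly !meval_simp. Qed.

Lemma evalpt_dellipsoid (a b c : R) p (i : 'I_3) :
  evalpt (ellipsoid_poly a b c)^`M(i) p =
  2 * (tnth [tuple (a ^+ 2)^-1; (b ^+ 2)^-1; (c ^+ 2)^-1] i * p ord0 i).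
Proof.
rewrite /evalpt /ellipsoid_poly !expr2 -mpolyC1 !mderiv_simp.
case: i => [[|[|[|//]]] lti]; rewrite (tnth_nth 0) /= !meval_simp ?rmorph0 ?rmorph1;
  rewrite (bool_irrelevance lti isT); ring.
Qed.

Lemma evalpt_vf_apply (X : vector_field R) f p :
  evalpt (vf_apply X f) p =
  \sum_(i < 3) evalpt (tnth X i) p * evalpt f^`M(i) p.
Proof.
rewrite /evalpt /vf_apply raddf_sum.
by apply: eq_bigr => i _; exact: mevalM.
Qed.

Lemma mderiv_plane (z0 : R) (i : 'I_3) : (plane_poly z0)^`M(i) = (iz == i)%:R.
Proof. by rewrite /plane_poly !mderiv_simp subr0. Qed.

Lemma vf_apply_plane (X : vector_field R) (z0 : R) :
  vf_apply X (plane_poly z0) = tnth X iz.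
Proof.
by rewrite /vf_apply sum_ord3 !mderiv_plane /= !mulr0 !add0r mulr1.
Qed.

End Coordinates.

(** * Parallels of the ellipsoid *)

Section Parallels.
Context {R : realType} (a b c : R).
Hypotheses (ha : 0 < a) (hb : 0 < b) (hc : 0 < c).

Lemma parallel_z (z0 : R) p : parallel a b c z0 p -> p ord0 iz = z0.
Proof. by move=> [hpl _]; apply/eqP; rewrite -subr_eq0 -evalpt_plane; apply/eqP. Qed.

Lemma parallel_has_pos_y (z0 : R) : `|z0| < c ->
  exists p, parallel a b c z0 p /\ 0 < p ord0 iy.
Proof.
move=> hz0.
have hsq : 0 < 1 - (z0 / c) ^+ 2.
  rewrite subr_gt0 -real_normK ?num_real // normrM normfV (gtr0_norm hc).
  have ge0 : 0 <= `|z0| / c by rewrite divr_ge0 // ltW.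
  by rewrite expr_lt1 // ltr_pdivrMr // mul1r.
(* the point of the parallel in the half-plane x = 0, y > 0 *)
exists (\row_i tnth [tuple 0; b * Num.sqrt (1 - (z0 / c) ^+ 2); z0] i).
rewrite mxE (tnth_nth 0) /=; split; last by rewrite mulr_gt0 // sqrtr_gt0.
split; rewrite /zero_locus /ellipsoid /=.
  by rewrite evalpt_plane mxE (tnth_nth 0) /= subrr.
rewrite /zero_locus /= evalpt_ellipsoid !mxE !(tnth_nth 0) /= exprMn.
rewrite sqr_sqrtr ?ltW //.
by field; rewrite !gt_eqF.
Qed.

(** If grad M were a multiple of grad (z - z0) = e_z, then x and y would vanish
    at the point, leaving only the poles z = c and z = -c. *)
Lemma parallel_gradients_free (z0 : R) p : `|z0| < c -> parallel a b c z0 p ->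
  free [:: gradient (ellipsoid_poly a b c) p; gradient (plane_poly z0) p].
Proof.
move=> hz0 hp.
have pz := parallel_z z0 p hp.
rewrite free_cons seq1_free span_seq1; apply/andP; split; last first.
  apply/eqP => /rowP /(_ iz); rewrite !mxE mderiv_plane eqxx /evalpt meval1.
  by move/eqP; rewrite oner_eq0.
apply/negP => /vlineP [k /rowP grad].
have xy0 (i : 'I_3) : iz != i -> p ord0 i = 0.
  move=> hi; have := grad i.
  rewrite !mxE evalpt_dellipsoid mderiv_plane (negPf hi) /evalpt meval0 mulr0.
  move/eqP; rewrite !mulf_eq0 pnatr_eq0 /= => /orP [|/eqP //].
  by case: i {hi} => [[|[|[|//]]] ?];
    rewrite (tnth_nth 0) /= invr_eq0 expf_eq0 /= gt_eqF.
have : evalpt (ellipsoid_poly a b c) p = 0 := hp.2.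
rewrite evalpt_ellipsoid (xy0 ix) // (xy0 iy) // pz expr0n /= !mulr0 !add0r => /eqP.
rewrite subr_eq0 => /eqP hz.
have : z0 ^+ 2 < c ^+ 2.
  by rewrite -[z0 ^+ 2]real_normK ?num_real // ltr_pXn2r ?nnegrE // ltW.
suff -> : z0 ^+ 2 = c ^+ 2 by rewrite ltxx.
have c2 : c ^+ 2 != 0 by rewrite expf_neq0 // gt_eqF.
by rewrite -[LHS](mulKf c2) mulrCA hz mulr1.
Qed.

(** * Vector fields whose third component is a multiple of y z *)

Variables (X : vector_field R) (K : R).
Hypothesis Xz : tnth X iz = K *: (vary * varz).

Lemma equator_invariant : invariant_on_ellipsoid a b c X (plane_poly 0).
Proof.
split; last by move=> p; apply: parallel_gradients_free; rewrite normr0.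
exists (K *: vary) => p _.
by rewrite vf_apply_plane Xz /plane_poly mpolyC0 subr0 -scalerAl.
Qed.

(** The polynomial K y z = X(z - z0) is a multiple of z - z0 on the ellipsoid, so
    it vanishes on the parallel, which has a point with y > 0; there z0 = z = 0. *)
Lemma invariant_parallel_height (z0 : R) : K != 0 -> `|z0| < c ->
  invariant_on_ellipsoid a b c X (plane_poly z0) -> z0 = 0.
Proof.
move=> K0 hz0 [[k Xk] _].
have [p [hp hy]] := parallel_has_pos_y z0 hz0.
have pz := parallel_z z0 p hp.
have kf0 : evalpt (k * plane_poly z0) p = 0.
  by rewrite /evalpt mevalM -/(evalpt (plane_poly z0) p) evalpt_plane pz subrr mulr0.
have := Xk p hp.2.
rewrite kf0 vf_apply_plane Xz /evalpt !meval_simp -?[Ordinal _]/iz pz.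
by move/eqP; rewrite !mulf_eq0 (negPf K0) (gt_eqF hy) => /eqP.
Qed.

Lemma card_invariant_parallels : K != 0 -> invariant_parallels a b c X #= `I_1.
Proof.
move=> K0.
suff -> : invariant_parallels a b c X = [set parallel a b c 0] by exact: card_set1.
apply/seteqP; split => C /=.
  by move=> [z0 [hz0 -> hinv]]; rewrite (invariant_parallel_height z0 K0 hz0 hinv).
by move=> ->; exists 0; rewrite normr0; split=> //; exact: equator_invariant.
Qed.

End Parallels.

(** * The quadratic system *)

Section QuadraticSystem.
Context {R : realType} (a b c a010 k010 b002 : R).
Hypotheses (ha : 0 < a) (hb : 0 < b) (hc : 0 < c).

Notation X := (quadratic_system a b c a010 k010 b002).

(** The part of the second component in k010 is built so that its product with
    2 y / b^2, together with the contribution of the third component, is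
    k010 y M; the terms in a010 and in b002 cancel between components. *)
Lemma quadratic_system_cofactor p :
  evalpt (vf_apply X (ellipsoid_poly a b c)) p =
  k010 * p ord0 iy * evalpt (ellipsoid_poly a b c) p.
Proof.
rewrite evalpt_vf_apply evalpt_ellipsoid sum_ord3 !evalpt_dellipsoid.
rewrite !(tnth_nth 0) /=.
rewrite /evalpt !expr2 !meval_simp.
by field; rewrite !gt_eqF.
Qed.

Lemma third_coef_neq0 : b ^+ 2 * k010 != 2 * b002 * c ^+ 2 ->
  2^-1 * (- (2 * b002 * c ^+ 2 / b ^+ 2) + k010) != 0.
Proof.
apply: contra_neq => /eqP; rewrite mulf_eq0 invr_eq0 pnatr_eq0 /= addrC subr_eq0.
by move/eqP->; rewrite mulrCA divff ?mulr1 // expf_neq0 // gt_eqF.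
Qed.

(** The coefficients of y^2 and z^2 are k010 / 2 and b002, so one of these two
    monomials survives. *)
Lemma msize_second : (k010 != 0) || (b002 != 0) -> msize (tnth X iy) = 3.
Proof.
move=> nz; rewrite (tnth_nth 0) /=; set P := (X in msize X).
have -> : P = (- (2^-1 * b ^+ 2 * k010))%:MP
    + (- (2^-1 * b ^+ 2 * (a ^+ 2)^-1 * (2 * a010))) *: varx
    + (2^-1 * b ^+ 2 * (a ^+ 2)^-1 * k010) *: varx ^+ 2
    + (2^-1 * k010) *: vary ^+ 2 + (2^-1 * (2 * b002)) *: varz ^+ 2.
  by rewrite /P -!mul_mpolyC !(mpolyCM, mpolyCN); ring.
set cc := - _; set cx := - _; set cxx := _ * k010; set cyy := _ * k010.
set czz := _ * (2 * _); apply/eqP; rewrite eqn_leq; apply/andP; split.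
  have le_sqr (k : R) (i : 'I_3) : (msize (k *: 'X_i ^+ 2) <= 3)%N.
    by apply: leq_trans (msizeZ_le _ _) _; rewrite mpolyXn msizeX mdegMn mdeg1.
  have le_lin (k : R) (i : 'I_3) : (msize (k *: 'X_i) <= 3)%N.
    by apply: leq_trans (msizeZ_le _ _) _; rewrite msizeXU.
  have leD (p q : {mpoly R[3]}) :
      (msize p <= 3 -> msize q <= 3 -> msize (p + q) <= 3)%N.
    by move=> hp hq; apply: leq_trans (msizeD_le _ _) _; rewrite geq_max hp.
  apply: (leD _ _ _ (le_sqr czz iz)); apply: (leD _ _ _ (le_sqr cyy iy)).
  apply: (leD _ _ _ (le_sqr cxx ix)); apply: (leD _ _ _ (le_lin cx ix)).
  by rewrite msizeC; case: eqP.
have [j hj] : exists j : 'I_3,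
    (cc%:MP + cx *: varx + cxx *: varx ^+ 2 + cyy *: vary ^+ 2
     + czz *: varz ^+ 2)@_(U_(j) *+ 2)%MM != 0.
  case/orP: nz => h; [exists iy | exists iz];
  rewrite !(mcoeffD, mcoeffZ) mcoeff_const_sqr mcoeff_lin_sqr !mcoeff_sqr /=;
  by rewrite !mulr0 !(addr0, add0r) mulr1 !mulf_neq0 // ?invr_neq0 ?pnatr_eq0.
by rewrite -mcoeff_msupp in hj; have := msize_mdeg_lt hj; rewrite mdegMn mdeg1.
Qed.

Lemma quadratic_system_degrees : a010 != 0 ->
  b ^+ 2 * k010 != 2 * b002 * c ^+ 2 -> vf_degrees X = [:: 2; 2; 1]%N.
Proof.
move=> ha010 hkb; rewrite /vf_degrees /=.
have := msize_second; rewrite (tnth_nth 0) /= => -> //; last first.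
  rewrite -negb_and; apply: contra hkb => /andP [/eqP -> /eqP ->].
  by rewrite !(mulr0, mul0r).
have X0 (i : 'I_3) : ('X_i : {mpoly R[3]}) != 0 by rewrite -msize_poly_eq0 msizeXU.
by rewrite !msizeZ ?third_coef_neq0 // msizeM ?X0 // !msizeXU.
Qed.

End QuadraticSystem.

Theorem proposition9 (R : realType) (a b c a010 k010 b002 : R)
    (ha : 0 < a) (hb : 0 < b) (hc : 0 < c)
    (ha010 : a010 != 0) (hkb : b ^+ 2 * k010 != 2 * b002 * c ^+ 2) :
  let X := quadratic_system a b c a010 k010 b002 in
  [/\ system_on_ellipsoid a b c X,
      vf_degrees X = [:: 2; 2; 1]%N
    & invariant_parallels a b c X #= `I_1].
Proof.
move=> X; split.
- by move=> p hp; rewrite quadratic_system_cofactor // [evalpt _ p]hp mulr0.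
- exact: quadratic_system_degrees.
- have Xz : tnth X iz =
      (2^-1 * (- (2 * b002 * c ^+ 2 / b ^+ 2) + k010)) *: (vary * varz).
    by rewrite (tnth_nth 0).
  apply: (card_invariant_parallels a b c ha hb hc X _ Xz).
  exact: third_coef_neq0.
Qed.
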